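(* Let $G=(V,E)$ be a finite connected simple graph with vertex set $V=\{a_1,\dots,a_N\}$, $N\ge 2$, let $\Psi=(\Psi_i)_{i=1}^N\in\mathbb{R}^N$ be a given potential on $V$, and let $\beta>0$. Let $\rho^o=(\rho^o_i)_{i=1}^N\in\mathcal{M}$ and let $\rho(t)=(\rho_i(t))_{i=1}^N:[0,\infty)\to\mathcal{M}$ be the solution, with initial value $\rho(0)=\rho^o$, of the system of ordinary differential equations (Fokker–Planck equation II) $$\frac{d\rho_i}{dt}=\sum_{j\in N(i),\,\bar\Psi_j>\bar\Psi_i}(\bar\Psi_j-\bar\Psi_i)\rho_j+\sum_{j\in N(i),\,\bar\Psi_j<\bar\Psi_i}(\bar\Psi_j-\bar\Psi_i)\rho_i,\qquad \bar\Psi_i=\Psi_i+\beta\log\rho_i,\qquad i=1,\dots,N.$$ Then $$H(\rho(t)\,|\,\rho^* )\le H(\rho^o\,|\,\rho^* )\,e^{-ct}\quad\text{for all } t\ge 0,\qquad c=\beta\gamma_0\,\frac{\min\{\rho^*_i:1\le i\le N\}}{\max\{\rho_i^*:1\le i\le N\}},$$ where $\rho^*$ is the Gibbs distribution and $\gamma_0$ is the modified logarithmic Sobolev constant of $G$ (with respect to $\rho^*$).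
   Context: $\mathcal{M}=\{\rho=(\rho_i)_{i=1}^N\in\mathbb{R}^N:\ \sum_{i=1}^N\rho_i=1,\ \rho_i>0 \text{ for all } i\}$ is the set of positive probability distributions on $V$. $N(i)=\{j:\{a_i,a_j\}\in E\}$ is the set of indices of neighbors of $a_i$. The Gibbs distribution $\rho^*=(\rho^*_i)_{i=1}^N\in\mathcal{M}$ is $\rho_i^*=\frac1K e^{-\Psi_i/\beta}$ with $K=\sum_{i=1}^N e^{-\Psi_i/\beta}$. The relative entropy of $\nu\in\mathcal{M}$ with respect to $\mu\in\mathcal{M}$ is $H(\nu|\mu)=\sum_{i=1}^N\nu_i\log\frac{\nu_i}{\mu_i}$. The modified logarithmic Sobolev constant $\gamma_0=\gamma_0(G)$ is the optimal (largest) $\gamma_0>0$ such that $2\gamma_0\,\mathrm{Ent}(f)\le\mathcal{E}(f,\log f)$ for all $f:V\to\mathbb{R}$ with $f>0$, where $$\mathrm{Ent}(f)=\mathrm{E}_{\rho^*}(f\log f)-(\mathrm{E}_{\rho^*}f)\log(\mathrm{E}_{\rho^*}f),\qquad \mathrm{E}_{\rho^*}g=\sum_{i=1}^N g(a_i)\rho_i^*,$$ $$\mathcal{E}(f,\log f)=\sum_{i=1}^N\sum_{j\in N(i)}\big(\log f(a_i)-\log f(a_j)\big)\big(f(a_i)-f(a_j)\big)\rho_i^*.$$ *)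

(* Defs.v *)
From HB Require Import structures.
From mathcomp Require Import all_boot all_order all_algebra.
From mathcomp Require Import all_classical all_reals all_analysis.

Set Implicit Arguments.
Unset Strict Implicit.
Unset Printing Implicit Defensive.

Import Order.TTheory GRing.Theory Num.Theory.
Import numFieldNormedType.Exports.
Local Open Scope classical_set_scope.
Local Open Scope ring_scope.

(* The vertex a_i is represented by its index i : 'I_N, the graph by its
   adjacency relation e (so N(i) is [pred j | e i j]), and vectors of R^N and
   functions V -> R alike by functions 'I_N -> R. *)

Definition simple_graph (N : nat) (e : rel 'I_N) : Prop :=
  symmetric e /\ irreflexive e.

Definition connected_graph (N : nat) (e : rel 'I_N) : Prop :=
  forall i j : 'I_N, connect e i j.

Section Definitions.
Variables (R : realType) (N : nat).
Implicit Types (e : rel 'I_N) (Psi mu nu f g : 'I_N -> R) (beta : R).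

Definition pos_distribution mu : Prop :=
  (forall i, 0 < mu i) /\ \sum_i mu i = 1.

Definition partition_function Psi beta : R := \sum_i expR (- Psi i / beta).

Definition gibbs Psi beta : 'I_N -> R :=
  fun i => (partition_function Psi beta)^-1 * expR (- Psi i / beta).

Definition relative_entropy nu mu : R := \sum_i nu i * ln (nu i / mu i).

Definition expect mu g : R := \sum_i g i * mu i.

Definition Ent mu f : R :=
  expect mu (fun i => f i * ln (f i)) - expect mu f * ln (expect mu f).

(* Every edge is counted twice, once with the weight of each endpoint. *)
Definition dirichlet e mu f g : R :=
  \sum_i \sum_(j | e i j) (g i - g j) * (f i - f j) * mu i.

Definition mls_inequality e mu (c : R) : Prop :=
  forall f, (forall i, 0 < f i) ->
    2 * c * Ent mu f <= dirichlet e mu f (fun i => ln (f i)).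

(* The optimal constant. If e is connected, 2 <= N and mu is a positive
   distribution, the set is nonempty and bounded above; as mls_inequality is a
   closed condition on c, the supremum is then its largest element. *)
Definition mls_constant e mu : R :=
  sup [set c : R | 0 < c /\ mls_inequality e mu c].

Definition modified_potential Psi beta mu : 'I_N -> R :=
  fun i => Psi i + beta * ln (mu i).

Definition fokker_planck_rhs e Psi beta mu : 'I_N -> R :=
  let P := modified_potential Psi beta mu in
  fun i => \sum_(j | e i j && (P i < P j)) (P j - P i) * mu j
         + \sum_(j | e i j && (P j < P i)) (P j - P i) * mu i.

(* A solution on [0, +oo[ with values in the positive distributions; the values
   of rho at negative times are irrelevant, and the derivative at 0 is
   one-sided. *)
Definition fokker_planck_solution e Psi beta (rho0 : 'I_N -> R)
    (rho : R -> 'I_N -> R) : Prop :=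
  [/\ forall t : R, 0 <= t -> pos_distribution (rho t),
      rho 0 = rho0,
      forall (t : R) i, 0 < t ->
        is_derive t 1 (fun s => rho s i)
          (fokker_planck_rhs e Psi beta (rho t) i)
    & forall i, h^-1 * (rho h i - rho 0 i) @[h --> 0^'+] -->
        fokker_planck_rhs e Psi beta (rho 0) i].

(* The default values 1 and 0 are neutral, the entries of a positive
   distribution being in ]0, 1]. *)
Definition min_mass mu : R := \big[Num.min/1]_i mu i.
Definition max_mass mu : R := \big[Num.max/0]_i mu i.

End Definitions.

(* Main.v *)
(* Put f = rho / rho^*. Up to a constant the modified potential is beta log f, so
   summing by parts gives, over ordered pairs of neighbours,
     - d/dt H = beta/2 sum_(i ~ j) (log f_i - log f_j)^2 max(f_i, f_j) rho^*_k,
   where k is the endpoint at which f is larger. As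
   a (log a - log b) >= a - b, this is at least
     (beta/2) min rho^*_i sum_(i ~ j) (log f_i - log f_j) (f_i - f_j)
       >= (beta/2) (min rho^*_i / max rho^*_i) E(f, log f)
       >= c Ent f = c H,
   and Gronwall's inequality concludes. *)
Require Import Defs.
From HB Require Import structures.
From mathcomp Require Import all_boot all_order all_algebra.
From mathcomp Require Import all_classical all_reals all_analysis.

From mathcomp Require Import ring lra.

Set Implicit Arguments.
Unset Strict Implicit.
Unset Printing Implicit Defensive.

Import Order.TTheory GRing.Theory Num.Theory.
Import numFieldNormedType.Exports.
Local Open Scope classical_set_scope.
Local Open Scope ring_scope.

(** * Calculus on the half-line and inequalities for the logarithm *)

(** Gronwall's inequality: [f s * expR (c * s)] has nonpositive derivative for [s > 0], and right
    continuity at 0 extends its monotonicity to the closed half-line. *)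
Lemma exp_decay (R : realType) (f df : R -> R) (c : R) :
  (forall t : R, 0 < t -> is_derive t 1 f (df t)) ->
  (forall t : R, 0 < t -> df t <= - c * f t) ->
  f t @[t --> 0^'+] --> f 0 ->
  forall t : R, 0 <= t -> f t <= f 0 * expR (- (c * t)).
Proof.
move=> fE dfle f0 t t0.
pose g (s : R) := f s * expR (c * s).
have gE (s : R) : 0 < s -> is_derive s 1 g (f s *: (c * expR (c * s)) + expR (c * s) *: df s).
  move=> s0; have fs := fE _ s0.
  have es : is_derive s 1 (fun s => expR (c * s)) (c * expR (c * s)).
    rewrite mulrC; apply: (is_derive1_comp (f := expR) (g := fun s => c * s)).
    have := is_deriveZ c (is_derive_id s (1 : R)).
    by rewrite /GRing.scale /= mulr1.
  exact: is_deriveM.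
suff : g t <= g 0.
  by rewrite /g mulr0 expR0 mulr1 expRN -ler_pdivlMr ?invr_gt0 ?expR_gt0// invrK.
apply: (@ler0_derive1_nincry _ g 0) => // [s|s|].
- by rewrite in_itv /= andbT => /gE gs; apply: ex_derive.
- rewrite in_itv /= andbT => s0; have gs := gE _ s0.
  rewrite derive1E derive_val /GRing.scale /=.
  have := dfle _ s0; have := expR_gt0 (c * s); nra.
- apply/continuous_within_itvcyP; split=> [s|].
    rewrite in_itv /= andbT => /gE gs.
    by apply: differentiable_continuous; apply/derivable1_diffP; apply: ex_derive.
  apply: cvgM => //.
  apply: (cvg_at_right_filter (f := fun x => expR (c * x))).
  apply: continuous_comp; last exact: continuous_expR.
  exact: mulrl_continuous.
Qed.

(** Supplies the continuity at 0 that [exp_decay] asks for, as the equation at time 0 only gives a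
    one-sided difference quotient; multiply it by [h]. *)
Lemma right_continuous_diff_quotient (R : realType) (f : R -> R) (l : R) :
  h^-1 * (f h - f 0) @[h --> 0^'+] --> l -> f h @[h --> 0^'+] --> f 0.
Proof.
move=> fl.
have : h * (h^-1 * (f h - f 0)) + f 0 @[h --> 0^'+] --> 0 * l + f 0.
  by apply: cvgD; [apply: cvgM => //; apply: cvg_at_right_filter; exact: cvg_id|exact: cvg_cst].
rewrite mul0r add0r; apply: cvg_trans; apply: near_eq_cvg.
near=> h; have h0 : h != 0 by rewrite gt_eqF//; near: h; exact: nbhs_right_gt.
by rewrite mulrA divff// mul1r subrK.
Unshelve. all: by end_near. Qed.

(** This is [ln (1 + x) <= x] at [x = a / b - 1], multiplied by [b]. It yields both the
    nonnegativity of the relative entropy and the estimate of the dissipation along an edge. *)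
Lemma le_diff_ln (R : realType) (a b : R) :
  0 < a -> 0 < b -> b - a <= b * (ln b - ln a).
Proof.
move=> a0 b0.
have : ln (1 + (a / b - 1)) <= a / b - 1.
  by apply: le_ln1Dx; rewrite -subr_gt0; have := divr_gt0 a0 b0; lra.
rewrite addrC subrK ln_div ?posrE// => h.
have : b * (ln a - ln b) <= b * (a / b - 1) by rewrite ler_pM2l.
have -> : b * (a / b - 1) = a - b by field; rewrite gt_eqF.
lra.
Qed.

Lemma ln_diff_sign (R : realType) (a b : R) :
  0 < a -> 0 < b -> 0 <= (ln a - ln b) * (a - b).
Proof.
move=> a0 b0; case: (leP a b) => ab.
  by apply: mulr_le0; rewrite subr_le0// ler_ln.
by apply: mulr_ge0; rewrite subr_ge0 ?ler_ln// ltW.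
Qed.

(** * Relative entropy and the modified logarithmic Sobolev constant *)

Section Entropy.
Variables (R : realType) (N : nat).
Implicit Types (e : rel 'I_N) (mu nu f : 'I_N -> R).

Lemma relative_entropy_ge0 nu mu :
  pos_distribution nu -> pos_distribution mu -> 0 <= relative_entropy nu mu.
Proof.
move=> [nu0 nu1] [mu0 mu1].
(* Equal total masses turn 0 into a sum that can be compared term by term. *)
have -> : 0 = \sum_i (nu i - mu i) :> R by rewrite sumrB nu1 mu1 subrr.
apply: ler_sum => i _.
by rewrite ln_div ?posrE//; apply: le_diff_ln.
Qed.

(** The density has mean 1 under [mu], so the second term of [Ent] is [1 * ln 1 = 0]. *)
Lemma Ent_density nu mu : pos_distribution nu -> pos_distribution mu ->
  Ent mu (fun i => nu i / mu i) = relative_entropy nu mu.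
Proof.
move=> [nu0 nu1] [mu0 mu1]; rewrite /Ent /expect.
have E i : nu i / mu i * mu i = nu i by rewrite divfK// gt_eqF.
under [X in _ - X * _]eq_bigr do rewrite E.
rewrite nu1 mul1r; under [X in _ - ln X]eq_bigr do rewrite E.
rewrite nu1 ln1 subr0; apply: eq_bigr => i _.
by rewrite mulrAC E.
Qed.

Lemma mls_constant_le e mu f : (forall i, 0 < mu i) -> (forall i, 0 < f i) ->
  0 <= Ent mu f ->
  2 * mls_constant e mu * Ent mu f <= dirichlet e mu f (fun i => ln (f i)).
Proof.
move=> mu0 f0 Ef.
have D0 : 0 <= dirichlet e mu f (fun i => ln (f i)).
  apply: sumr_ge0 => i _; apply: sumr_ge0 => j _.
  by apply: mulr_ge0; [exact: ln_diff_sign|exact: ltW].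
rewrite /mls_constant; set S := (X in sup X).
(* If no constant is admissible, [sup] takes the value 0 and [D0] suffices. *)
have [->|/set0P S0] := eqVneq S set0; first by rewrite sup0 mulr0 mul0r.
move: Ef; rewrite le_eqVlt => /predU1P[<-|Ef]; first by rewrite mulr0.
(* For positive entropy, the quotient of the Dirichlet form by [2 * Ent mu f] bounds every
   admissible constant, hence their supremum; that the supremum is attained need not be shown. *)
rewrite mulrAC -ler_pdivlMl ?mulr_gt0//; apply: ge_sup => // c [_ /(_ _ f0)].
by rewrite ler_pdivlMl ?mulr_gt0// mulrAC.
Qed.

(** The second sum comes from differentiating the logarithm; it vanishes along flows that conserve
    mass. *)
Lemma is_derive_relative_entropy (rho : R -> 'I_N -> R) mu (d : 'I_N -> R) t :
  (forall i, 0 < mu i) -> (forall i, 0 < rho t i) ->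
  (forall i, is_derive t 1 (fun s => rho s i) (d i)) ->
  is_derive t 1 (fun s => relative_entropy (rho s) mu)
    (\sum_i d i * ln (rho t i / mu i) + \sum_i d i).
Proof.
move=> mu0 r0 dE.
rewrite -big_split /=.
have -> : (fun s => relative_entropy (rho s) mu) =
    \sum_i (fun s => rho s i * ln (rho s i / mu i)).
  by apply/funext => s; rewrite fct_sumE.
apply: is_derive_sum => i; have di := dE i.
have lE : is_derive t 1 (fun s => ln (rho s i / mu i)) ((rho t i / mu i)^-1 * (d i / mu i)).
  apply: (is_derive1_comp (f := @ln R) (g := fun s => rho s i / mu i)).
    by apply: is_derive1_ln; exact: divr_gt0.
  have := is_deriveZ (mu i)^-1 di.
  rewrite /GRing.scale /= mulrC.
  by congr is_derive; apply/funext => s /=; rewrite mulrC.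
have := is_deriveM di lE; congr is_derive.
rewrite /GRing.scale /=; move: (mu0 i) (r0 i) => mi ri.
by field; rewrite !gt_eqF.
Qed.

Lemma cvg_relative_entropy (rho : R -> 'I_N -> R) mu :
  (forall i, 0 < mu i) -> (forall i, 0 < rho 0 i) ->
  (forall i, rho t i @[t --> 0^'+] --> rho 0 i) ->
  relative_entropy (rho t) mu @[t --> 0^'+] --> relative_entropy (rho 0) mu.
Proof.
move=> mu0 r0 rc; apply: cvg_big => [|i _]; first exact: add_continuous.
apply: cvgM => //; apply: continuous_cvg; first by apply: continuous_ln; exact: divr_gt0.
by apply: cvgMl.
Qed.

End Entropy.

(** * Fluxes along edges and entropy dissipation *)

Section Flux.
Variables (R : realType) (N : nat).
Implicit Types (e : rel 'I_N) (Psi mu : 'I_N -> R) (beta : R).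

(** Discrete integration by parts: swap [i] and [j] in one of the two copies of the sum. The factor
    2 reflects that each edge is counted in both directions. *)
Lemma sum_antisym e (F : 'I_N -> 'I_N -> R) (g : 'I_N -> R) : symmetric e ->
  (forall i j, F j i = - F i j) ->
  2 * \sum_i (\sum_(j | e i j) F i j) * g i =
  \sum_i \sum_(j | e i j) F i j * (g i - g j).
Proof.
move=> sym_e Fa.
under eq_bigr do rewrite mulr_suml.
rewrite mulr2n mulrDl mul1r.
under [RHS]eq_bigr do (under eq_bigr do rewrite mulrBr; rewrite sumrB).
rewrite sumrB; congr (_ + _).
under [X in - X]eq_bigr do rewrite big_mkcond /=.
rewrite exchange_big /= -sumrN; apply: eq_bigr => i _.
rewrite -sumrN big_mkcond; apply: eq_bigr => j _.
by rewrite sym_e; case: ifP; rewrite ?oppr0// (Fa i j) mulNr opprK.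
Qed.

(** Net flow from [j] into [i], carrying the mass of the endpoint of higher potential. In case of a
    tie the first factor is 0, so the choice of endpoint is immaterial. *)
Definition upwind_flux (P mu : 'I_N -> R) (i j : 'I_N) : R :=
  (P j - P i) * (if P i < P j then mu j else mu i).

Lemma upwind_flux_antisym (P mu : 'I_N -> R) i j :
  upwind_flux P mu j i = - upwind_flux P mu i j.
Proof.
rewrite /upwind_flux -mulNr opprB.
by case: (ltgtP (P i) (P j)) => // ->; rewrite subrr !mul0r.
Qed.

Lemma fokker_planck_rhsE e Psi beta mu i :
  fokker_planck_rhs e Psi beta mu i =
  \sum_(j | e i j) upwind_flux (modified_potential Psi beta mu) mu i j.
Proof.
rewrite /fokker_planck_rhs; set P := modified_potential _ _ _.
rewrite !big_mkcondr -big_split; apply: eq_bigr => j _; rewrite /upwind_flux.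
case: (ltgtP (P i) (P j)) => [_|_|->] /=; rewrite ?addr0 ?add0r//.
by rewrite subrr mul0r.
Qed.

Lemma partition_function_gt0 Psi beta : (0 < N)%N ->
  0 < partition_function Psi beta.
Proof.
move=> N0; rewrite /partition_function (bigD1 (Ordinal N0))//=.
by rewrite ltr_pwDl ?expR_gt0// sumr_ge0// => j _; exact: expR_ge0.
Qed.

Lemma gibbs_pos_distribution Psi beta : (0 < N)%N ->
  pos_distribution (gibbs Psi beta).
Proof.
move=> /(partition_function_gt0 Psi beta) K0; split=> [i|].
  by rewrite mulr_gt0 ?invr_gt0 ?expR_gt0.
by rewrite -mulr_sumr mulVf// gt_eqF.
Qed.

(** With [f] the density of [mu] relative to the Gibbs distribution and [K] the partition function,
    the modified potential is [beta * ln f - beta * ln K]; the constant cancels in differences. *)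
Lemma modified_potential_diff Psi beta mu i j : (0 < N)%N -> 0 < beta ->
  (forall i, 0 < mu i) ->
  modified_potential Psi beta mu i - modified_potential Psi beta mu j =
  beta * (ln (mu i / gibbs Psi beta i) - ln (mu j / gibbs Psi beta j)).
Proof.
move=> N0 b0 mu0; have [g0 _] := gibbs_pos_distribution Psi beta N0.
have K0 := partition_function_gt0 Psi beta N0.
rewrite !ln_div ?posrE// /gibbs !lnM ?posrE ?invr_gt0 ?expR_gt0// !expRK.
by rewrite /modified_potential; field; rewrite gt_eqF.
Qed.

Lemma upwind_flux_dissipation Psi beta mu i j : (0 < N)%N -> 0 < beta ->
  (forall i, 0 < mu i) ->
  let f k := mu k / gibbs Psi beta k in
  upwind_flux (modified_potential Psi beta mu) mu i j * (ln (f i) - ln (f j)) <=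
  - (beta * min_mass (gibbs Psi beta)) * ((ln (f i) - ln (f j)) * (f i - f j)).
Proof.
move=> N0 b0 mu0 /=; pose f k := mu k / gibbs Psi beta k.
rewrite -!/(f _); have [g0 _] := gibbs_pos_distribution Psi beta N0.
have f0 k : 0 < f k by exact: divr_gt0.
have muE k : mu k = f k * gibbs Psi beta k by rewrite divfK// gt_eqF.
have mle k : min_mass (gibbs Psi beta) <= gibbs Psi beta k by exact: bigmin_le.
have m0 : 0 <= min_mass (gibbs Psi beta).
  by apply: le_bigmin => // k _; exact: ltW.
(* Written as the sign of a difference, the upwind test becomes a comparison of [ln (f i)] and
   [ln (f j)]. *)
rewrite /upwind_flux -subr_gt0 !modified_potential_diff// -/(f i) -/(f j).
rewrite pmulr_rgt0// subr_gt0.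
set m := min_mass _ in mle m0 *.
(* Here [k] is the endpoint whose mass is carried; the two directions of flow are the two instances
   of [key]. *)
suff key k l : ln (f l) <= ln (f k) ->
    m * ((ln (f k) - ln (f l)) * (f k - f l)) <= (ln (f k) - ln (f l)) ^+ 2 * mu k.
  case: ltP => [/ltW|] /key; nra.
rewrite -subr_ge0 => d0; rewrite muE.
(* In [mu k = f k * gibbs Psi beta k], the factor [f k] turns one logarithmic difference into at
   least [f k - f l], and the Gibbs weight is at least [m]. *)
have h1 := le_diff_ln (f0 l) (f0 k).
have h2 : (ln (f k) - ln (f l)) * (f k - f l) <= (ln (f k) - ln (f l)) * (f k * (ln (f k) - ln (f l))).
  exact: ler_wpM2l.
apply: le_trans (ler_wpM2l m0 h2) _.
have -> : (ln (f k) - ln (f l)) ^+ 2 * (f k * gibbs Psi beta k) =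
  gibbs Psi beta k * ((ln (f k) - ln (f l)) * (f k * (ln (f k) - ln (f l)))) by ring.
apply: ler_wpM2r => //; do 2 apply: mulr_ge0 => //; exact: ltW.
Qed.

(** Conservation of mass: summation by parts against the constant function 1. *)
Lemma sum_fokker_planck_rhs e Psi beta mu : symmetric e ->
  \sum_i fokker_planck_rhs e Psi beta mu i = 0.
Proof.
move=> sym_e.
have := sum_antisym (fun=> 1) sym_e
  (upwind_flux_antisym (modified_potential Psi beta mu) mu).
under [RHS]eq_bigr do (under eq_bigr do rewrite subrr mulr0; rewrite big1_eq).
rewrite big1_eq; under eq_bigr do rewrite mulr1 -fokker_planck_rhsE.
by move/eqP; rewrite mulf_eq0 pnatr_eq0 => /eqP.
Qed.

Lemma entropy_production_le e Psi beta mu : (0 < N)%N -> symmetric e ->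
  0 < beta -> pos_distribution mu ->
  let rhos := gibbs Psi beta in
  \sum_i fokker_planck_rhs e Psi beta mu i * ln (mu i / rhos i) <=
  - (beta * mls_constant e rhos * (min_mass rhos / max_mass rhos)) *
    relative_entropy mu rhos.
Proof.
move=> N0 sym_e b0 muP /=; set rhos := gibbs Psi beta; have [mu0 mu1] := muP.
have gP : pos_distribution rhos by exact: gibbs_pos_distribution.
have [g0 _] := gP.
pose f k := mu k / rhos k.
have f0 k : 0 < f k by exact: divr_gt0.
have m0 : 0 <= min_mass rhos by apply: le_bigmin => // k _; exact: ltW.
have gM k : rhos k <= max_mass rhos by exact: le_bigmax.
have M0 : 0 < max_mass rhos := lt_le_trans (g0 (Ordinal N0)) (gM _).
have h1 := mls_constant_le e g0 f0.
rewrite Ent_density// in h1; have {}h1 := h1 (relative_entropy_ge0 muP gP).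
(* The Dirichlet form without its weights: [max_mass] enters when comparing it with [dirichlet],
   [min_mass] when comparing it with the dissipation. *)
pose D := \sum_i \sum_(j | e i j) (ln (f i) - ln (f j)) * (f i - f j).
have h2 : dirichlet e rhos f (fun i => ln (f i)) <= D * max_mass rhos.
  rewrite /D mulr_suml; apply: ler_sum => i _; rewrite mulr_suml.
  by apply: ler_sum => j _; apply: ler_wpM2l => //; exact: ln_diff_sign.
have h3 : 2 * \sum_i fokker_planck_rhs e Psi beta mu i * ln (f i) <=
    - (beta * min_mass rhos) * D.
  under eq_bigr do rewrite fokker_planck_rhsE.
  rewrite (sum_antisym _ sym_e (upwind_flux_antisym _ _)) /D mulr_sumr.
  apply: ler_sum => i _; rewrite mulr_sumr; apply: ler_sum => j _.
  exact: upwind_flux_dissipation.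
have {}h2 : 2 * mls_constant e rhos * relative_entropy mu rhos / max_mass rhos <= D.
  by rewrite ler_pdivrMr//; exact: le_trans h2.
have bm0 : 0 <= beta * min_mass rhos by rewrite mulr_ge0// ltW.
(* The 2 from summation by parts cancels the 2 of the Sobolev inequality, so the rate carries no
   numerical factor. *)
have := ler_wpM2l bm0 h2.
rewrite -/(f _); nra.
Qed.

End Flux.

Theorem theorem3p6 (R : realType) (N : nat) (hN : (2 <= N)%N)
    (e : rel 'I_N) (he : simple_graph e) (hconn : connected_graph e)
    (Psi : 'I_N -> R) (beta : R) (hbeta : 0 < beta)
    (rho0 : 'I_N -> R) (hrho0 : pos_distribution rho0)
    (rho : R -> 'I_N -> R)
    (hrho : fokker_planck_solution e Psi beta rho0 rho) :
  let rhos := gibbs Psi beta in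
  let c := beta * mls_constant e rhos * (min_mass rhos / max_mass rhos) in
  forall t : R, 0 <= t ->
    relative_entropy (rho t) rhos <= relative_entropy rho0 rhos * expR (- (c * t)).
Proof.
move=> rhos c; have N0 : (0 < N)%N by exact: ltnW.
have [sym_e _] := he; have [rhoP rho_0 rhoD rhoD0] := hrho.
have [g0 _] : pos_distribution rhos by exact: gibbs_pos_distribution.
rewrite -rho_0.
apply: (exp_decay (f := fun t => relative_entropy (rho t) rhos)
  (df := fun t => \sum_i fokker_planck_rhs e Psi beta (rho t) i * ln (rho t i / rhos i))).
- move=> t t0; have [r0 _] := rhoP _ (ltW t0).
  have := is_derive_relative_entropy g0 r0 (fun i => rhoD t i t0).
  (* Mass conservation removes the extra sum in the derivative of the entropy. *)
  by rewrite sum_fokker_planck_rhs// addr0.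
- by move=> t t0; apply: entropy_production_le => //; exact: rhoP (ltW t0).
- apply: cvg_relative_entropy => // [i|i]; first by have [] := rhoP 0 (lexx 0).
  exact: right_continuous_diff_quotient (rhoD0 i).
Qed.
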